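(* Let $\mathbf{A} \in \mathbb{R}^{I \times J}$ and $\mathbf{B} \in \mathbb{R}^{K \times J}$ with $I > J$ and $K > J$, both of full column rank. Then $\mu(\mathbf{A} \odot \mathbf{B}) \leq \mu(\mathbf{A})\,\mu(\mathbf{B})$, where $\odot$ is the Khatri-Rao product and $\mu$ denotes coherence.
   Context: Leverage scores: for $\mathbf{M} \in \mathbb{R}^{n \times d}$ with $n > d$ (of full column rank), the leverage score of row $i$ is $l_i = \|\mathbf{U}(i,:)\|_2^2$ for $i \in \{1,\dots,n\}$, where $\mathbf{U} \in \mathbb{R}^{n\times d}$ is the matrix whose columns are the $d$ left singular vectors of $\mathbf{M}$ from its reduced SVD (an orthonormal basis of the column space of $\mathbf{M}$), and $\mathbf{U}(i,:)$ is its $i$th row. These numbers do not depend on the choice of orthonormal basis of the column space. Coherence: $\mu(\mathbf{M}) = \max_{i \in \{1,\dots,n\}} l_i$, the maximum leverage score of $\mathbf{M}$. Khatri-Rao product (columnwise Kronecker product): for $\mathbf{A} \in \mathbb{R}^{I\times J}$ with columns $\mathbf{a}_1,\dots,\mathbf{a}_J$ and $\mathbf{B} \in \mathbb{R}^{K\times J}$ with columns $\mathbf{b}_1,\dots,\mathbf{b}_J$, $\mathbf{A}\odot\mathbf{B} = [\,\mathbf{a}_1\otimes\mathbf{b}_1 \;\; \mathbf{a}_2\otimes\mathbf{b}_2 \;\cdots\; \mathbf{a}_J\otimes\mathbf{b}_J\,] \in \mathbb{R}^{IK\times J}$, where $\otimes$ is the Kronecker product of column vectors. When $\mathbf{A}$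 and $\mathbf{B}$ have full column rank, so does $\mathbf{A}\odot\mathbf{B}$, so its coherence is defined. *)

(* Defs.v *)
From mathcomp Require Import all_boot all_order all_algebra.
From mathcomp Require Import boolp classical_sets reals.
From mathcomp.real_closed Require Import mxtens.

Set Implicit Arguments.
Unset Strict Implicit.
Unset Printing Implicit Defensive.

Import Order.TTheory GRing.Theory Num.Theory.
Local Open Scope classical_set_scope.
Local Open Scope ring_scope.

(* M = U diag(s) V^T, where U is n x d and V is d x d.  The singular values are
   not required to be sorted: sorting them only permutes the columns of U,
   which leaves the norms of the rows of U unchanged. *)
Definition reduced_svd (R : realType) (n d : nat)
    (M U : 'M[R]_(n, d)) (s : 'rV[R]_d) (V : 'M[R]_d) : Prop :=
  [/\ U^T *m U = 1%:M, V^T *m V = 1%:M, (forall j, 0 <= s 0 j)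
    & M = U *m diag_mx s *m V^T].

(* A reduced SVD is not unique, so one is chosen; when M has full column rank,
   the norms of the rows of U do not depend on the choice.  The default value 0
   is used only if M has no reduced SVD, i.e., if n < d. *)
Definition left_singular_mx (R : realType) (n d : nat) (M : 'M[R]_(n, d)) :
    'M[R]_(n, d) :=
  xget 0 [set U | exists (s : 'rV[R]_d) (V : 'M[R]_d), reduced_svd M U s V].

Definition leverage_score (R : realType) (n d : nat) (M : 'M[R]_(n, d))
    (i : 'I_n) : R :=
  \sum_(j < d) left_singular_mx M i j ^+ 2.

(* Leverage scores are nonnegative, so starting the maximum at 0 has no effect
   when n > 0. *)
Definition coherence (R : realType) (n d : nat) (M : 'M[R]_(n, d)) : R :=
  \big[Num.max/0]_(i < n) leverage_score M i.

(* [*t] is the Kronecker product.  A Kronecker product of two columns has type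
   'M_(I * K, 1 * 1), hence the column index 0. *)
Definition khatri_rao (R : realType) (I K J : nat)
    (A : 'M[R]_(I, J)) (B : 'M[R]_(K, J)) : 'M[R]_(I * K, J) :=
  \matrix_(i, j) (col j A *t col j B) i 0.

(* Main.v *)
(* If Q is an orthonormal basis of the column space of A ⊙ B, and U and V are
   orthonormal bases of those of A and B, then Q = (U ⊗ V) N, since
   (U S) ⊙ (V T) = (U ⊗ V) (S ⊙ T).  As U ⊗ V and Q have orthonormal columns, so
   has N, and Bessel's inequality bounds the norm of each row of Q by the norm of
   the corresponding row of U ⊗ V, which is the product of the norms of a row of U
   and a row of V.

   That the chosen U, V and Q are orthonormal requires reduced SVDs to exist, hence
   the real spectral theorem: a complex eigenvalue of a symmetric matrix is real,
   and a Householder reflection splits off its eigenvector. *)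
Require Import Defs.
From mathcomp Require Import all_boot all_order all_algebra.
From mathcomp Require Import classical_sets reals.
From mathcomp.real_closed Require Import complex mxtens.
From mathcomp Require Import ring.
Set Implicit Arguments.
Unset Strict Implicit.
Unset Printing Implicit Defensive.

Import Order.TTheory GRing.Theory Num.Theory.

Local Open Scope ring_scope.

(** * Spectral theorem for real symmetric matrices *)

(** Over the complex numbers [S] is Hermitian, so its spectral values are real; a real root of the
    complexified characteristic polynomial is a root of the original one. *)
Lemma symmetric_eigenvalue (R : rcfType) (n : nat) (S : 'M[R]_n.+1) :
  S^T = S -> exists a, eigenvalue S a.
Proof.
move=> symS; pose f := real_complex R; pose Sc := map_mx f S.
have hermSc : Sc \is hermsymmx.
  apply: realsym_hermsym.
    by apply/is_hermitianmxP; rewrite expr0 scale1r map_mx_id // /Sc map_trmx symS.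
  by apply/mxOverP => i j; rewrite !mxE complex_real.
have /hermitian_normalmx/orthomx_spectralP def_Sc := hermSc.
have /mxOverP diag_real := hermitian_spectral_diag_real hermSc.
have /complex_realP [a def_a] := diag_real 0 0.
exists a; rewrite eigenvalue_root_char.
rewrite -(fmorph_root f) map_char_poly -eigenvalue_root_char.
(* The rows of [spectralmx Sc] are eigenvectors, nonzero since that matrix is invertible. *)
apply/eigenvalueP; exists (row 0 (spectralmx Sc)); last first.
  apply/eqP => row0; have := row_free_unit (spectralmx Sc).
  rewrite spectral_unit => /row_freeP [Q /(congr1 (row 0))].
  rewrite row_mul row0 mul0mx => /rowP/(_ 0)/eqP.
  by rewrite !mxE eqxx eq_sym oner_eq0.
have /(congr1 (mulmx (spectralmx Sc))) := def_Sc.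
rewrite !mulmxA mulmxV ?spectral_unit // mul1mx => PSc.
by rewrite -row_mul PSc row_mul row_diag_mx -scalemxAl def_a -rowE.
Qed.

Lemma sum_sqr_mulmx_tr (R : comPzRingType) (n : nat) (v : 'rV[R]_n) :
  \sum_j v 0 j ^+ 2 = (v *m v^T) 0 0.
Proof. by rewrite !mxE; apply: eq_bigr => j _; rewrite mxE. Qed.

Lemma mulmx_tr_eq0 (R : realDomainType) (n : nat) (v : 'rV[R]_n) :
  (v *m v^T == 0) = (v == 0).
Proof.
apply/eqP/eqP => [v0|->]; last by rewrite mul0mx.
apply/rowP => j; apply/eqP; rewrite mxE -sqrf_eq0; apply/eqP.
move: j (erefl true); apply/psumr_eq0P => [j _|]; first exact: sqr_ge0.
by rewrite sum_sqr_mulmx_tr v0 mxE.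
Qed.

(* [H] is the reflection exchanging [v] and the first basis vector. *)
Lemma householder (R : realFieldType) (n : nat) (v : 'rV[R]_n.+1) :
  v *m v^T = 1%:M ->
  exists H : 'M[R]_n.+1, [/\ H^T = H, H *m H = 1%:M & row 0 H = v].
Proof.
move=> v1; pose e : 'rV[R]_n.+1 := delta_mx 0 0; pose w := v - e.
have [w0|wN0] := eqVneq w 0.
  exists 1%:M; split; rewrite ?trmx1 ?mulmx1 //.
  by rewrite row1; apply/esym/eqP; rewrite -subr_eq0; apply/eqP.
pose c := (w *m w^T) 0 0; have def_c : w *m w^T = c%:M by exact: mx11_scalar.
have cN0 : c != 0.
  by apply: contraNneq wN0 => c0; rewrite -mulmx_tr_eq0 def_c c0 raddf0.
(* As [v] and [e] are unit vectors, [c = |v - e|^2 = 2 - 2 <e, v>], whence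
   [<e, w> = <e, v> - 1 = - c / 2]. *)
have ewT : e *m w^T = - (c / 2)%:M.
  apply/rowP => j; rewrite {j}ord1.
  have e1 : e *m e^T = 1%:M.
    by rewrite trmx_delta mul_delta_mx; apply/rowP => j; rewrite !ord1 !mxE.
  have vev : v *m e^T = e *m v^T.
    by rewrite -[LHS]trmxK trmx_mul trmxK; apply/rowP => j; rewrite !ord1 mxE.
  move: def_c; rewrite /w linearB /= !mulmxBl !mulmxBr v1 e1 vev => /rowP/(_ 0).
  rewrite !mxE !eqxx /= !mulr1n => <-; by field.
pose H := 1%:M - (2 / c) *: (w^T *m w); exists H.
have symH : H^T = H by rewrite /H linearB linearZ /= trmx1 trmx_mul trmxK.
split=> //.
  have ww : w^T *m w *m (w^T *m w) = c *: (w^T *m w).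
    by rewrite mulmxA -[w^T *m w *m _]mulmxA def_c mul_mx_scalar scalemxAl.
  rewrite /H; move: (w^T *m w) ww => X ww.
  rewrite mulmxBl mul1mx mulmxBr mulmx1 -scalemxAl -scalemxAr ww !scalerA.
  have -> : 2 / c * (2 / c) * c = 2 / c + 2 / c by field.
  by rewrite scalerDl opprB addrK subrK.
rewrite rowE -/e /H mulmxBr mulmx1 -scalemxAr mulmxA ewT mulNmx mul_scalar_mx.
rewrite scalerN opprK scalerA.
have -> : 2 / c * (c / 2) = 1 by field.
by rewrite scale1r /w addrC subrK.
Qed.

(** Deflation: conjugating by a reflection whose first row is a unit eigenvector clears the first
    row of [S], and by symmetry the first column, off the diagonal; induction handles the remaining
    block. *)
Theorem real_spectral (R : rcfType) (n : nat) (S : 'M[R]_n) :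
  S^T = S ->
  exists (V : 'M[R]_n) (d : 'rV[R]_n),
    V^T *m V = 1%:M /\ S = V *m diag_mx d *m V^T.
Proof.
elim: n S => [|n IHn] S symS.
  by exists 1%:M, 0; split; apply/matrixP => -[].
have [a /eigenvalueP[u uS uN0]] := symmetric_eigenvalue symS.
have u_gt0 : 0 < (u *m u^T) 0 0.
  rewrite lt_def -sum_sqr_mulmx_tr sumr_ge0 ?andbT => [|j _]; last exact: sqr_ge0.
  apply: contraNneq uN0; rewrite sum_sqr_mulmx_tr => uu0.
  by rewrite -mulmx_tr_eq0 [_ *m _]mx11_scalar uu0 raddf0.
pose k := (Num.sqrt ((u *m u^T) 0 0))^-1; pose v := k *: u.
have v1 : v *m v^T = 1%:M.
  rewrite /v linearZ /= -scalemxAl -scalemxAr scalerA [u *m _]mx11_scalar.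
  by rewrite scale_scalar_mx -expr2 exprVn sqr_sqrtr ?ltW // mulVf ?gt_eqF.
have vS : v *m S = a *: v by rewrite /v -scalemxAl uS !scalerA mulrC.
have [H [symH HH row0H]] := householder v1.
pose T := H *m S *m H.
have symT : T^T = T by rewrite /T !trmx_mul symH symS mulmxA.
have row0T : row 0 T = a *: delta_mx 0 0.
  rewrite /T !row_mul row0H vS -scalemxAl -row0H -row_mul HH.
  by rewrite row1.
have def_S : S = H *m T *m H.
  by rewrite /T !mulmxA HH mul1mx -mulmxA HH mulmx1.
clearbody T.
(* The same matrix at the convertible size [1 + n], so that block operations apply. *)
pose T' : 'M[R]_(1 + n) := T.
have urT : ursubmx T' = 0.
  apply/matrixP => i j; rewrite ord1 !mxE.
  have /rowP/(_ (rshift 1 j)) := row0T; rewrite !mxE /= mulr0.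
  by move=> <-; congr (T _ _); apply: val_inj.
have def_T : T' = block_mx (ulsubmx T') 0 0 (drsubmx T').
  rewrite -[LHS]submxK urT; congr block_mx.
  by rewrite -[LHS]trmxK trmx_dlsub symT urT trmx0.
have [|V [d [V1 def_dr]]] := IHn (drsubmx T').
  by rewrite trmx_drsub symT.
pose W : 'M[R]_(1 + n) := block_mx 1%:M 0 0 V.
have W1 : W^T *m W = 1%:M.
  rewrite tr_block_mx mulmx_block !trmx0 trmx1 !(mulmx0, mul0mx, addr0, add0r).
  by rewrite mulmx1 V1 -scalar_mx_block.
have def_TW : T' = W *m diag_mx (row_mx (ulsubmx T') d) *m W^T.
  rewrite {1}def_T def_dr diag_mx_row tr_block_mx !mulmx_block.
  rewrite !trmx0 trmx1 !(mulmx0, mul0mx, addr0, add0r) mulmx1 mul1mx.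
  by congr block_mx; apply/matrixP => i j; rewrite !ord1 !mxE eqxx.
move: (row_mx _ d) def_TW => r def_TW.
exists (H *m W), r; split.
  by rewrite trmx_mul symH mulmxA -[_ *m H *m H]mulmxA HH mulmx1.
by rewrite def_S (def_TW : T = _) trmx_mul symH !mulmxA.
Qed.

(** * Existence of reduced SVDs *)

(** Diagonalising [M^T *m M] by [V] makes the columns of [M *m V] orthogonal, with squared norms
    [D]; normalising them gives [U], and the singular values are the square roots of [D]. *)
Lemma reduced_svd_exists (R : realType) (n d : nat) (M : 'M[R]_(n, d)) :
  row_full M -> exists U s V, reduced_svd M U s V.
Proof.
case/row_fullP => L LM.
have [|V [D [V1 def_MM]]] := @real_spectral R d (M^T *m M).
  by rewrite trmx_mul trmxK.
have V1' := mulmx1C V1; pose W := M *m V.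
have WW : W^T *m W = diag_mx D.
  rewrite trmx_mul mulmxA -[_ *m M]mulmxA def_MM !mulmxA V1 mul1mx.
  by rewrite -mulmxA V1 mulmx1.
(* A left inverse of [W] rules out zero columns, hence zero singular values. *)
have LW : V^T *m L *m W = 1%:M.
  by rewrite /W mulmxA -[_ *m L *m M]mulmxA LM mulmx1.
have D_gt0 j : 0 < D 0 j.
  have -> : D 0 j = ((col j W)^T *m (col j W)^T^T) 0 0.
    have /matrixP/(_ j j) := WW; rewrite !mxE eqxx mulr1n => <-.
    by apply: eq_bigr => i _; rewrite !mxE.
  rewrite lt_def -sum_sqr_mulmx_tr sumr_ge0 ?andbT => [|i _]; last exact: sqr_ge0.
  apply/eqP; rewrite sum_sqr_mulmx_tr => W0.
  have /eqP : (col j W)^T = 0.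
    by apply/eqP; rewrite -mulmx_tr_eq0 [_ *m _]mx11_scalar W0 raddf0.
  rewrite trmx_eq0 => /eqP colW0.
  have /(congr1 (col j))/colP/(_ j) := LW.
  rewrite colE -[_ *m W *m _]mulmxA -colE colW0 mulmx0 !mxE eqxx => /eqP.
  by rewrite eq_sym oner_eq0.
pose s : 'rV[R]_d := \row_j Num.sqrt (D 0 j).
pose r : 'rV[R]_d := \row_j (Num.sqrt (D 0 j))^-1.
have rs : diag_mx r *m diag_mx s = 1%:M.
  rewrite mulmx_diag -diag_const_mx; congr diag_mx; apply/rowP => j.
  by rewrite !mxE mulVf // sqrtr_eq0 -ltNge.
have ss : diag_mx s *m diag_mx s = diag_mx D.
  rewrite mulmx_diag; congr diag_mx; apply/rowP => j.
  by rewrite !mxE -expr2 sqr_sqrtr // ltW.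
exists (W *m diag_mx r), s, V; split=> //.
- rewrite trmx_mul tr_diag_mx mulmxA -[_ *m W]mulmxA WW -ss mulmxA rs mul1mx.
  exact: mulmx1C.
- by move=> j; rewrite mxE sqrtr_ge0.
by rewrite -[_ *m _ *m diag_mx s]mulmxA rs mulmx1 /W -mulmxA V1' mulmx1.
Qed.

(** The chosen matrix is an orthonormal basis of the column space of [M]. The factor [T] is
    [diag_mx s *m V^T], invertible because it is square and inherits a left inverse from [M]. *)
Lemma left_singular_mxP (R : realType) (n d : nat) (M : 'M[R]_(n, d)) :
  row_full M ->
  (left_singular_mx M)^T *m left_singular_mx M = 1%:M /\
  exists2 T, T \in unitmx & M = left_singular_mx M *m T.
Proof.
move=> fullM; have [U0 [s0 [V0 svd0]]] := reduced_svd_exists fullM.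
have [|s [V [UU VV _ def_M]]] := xgetPex 0 (_ : exists U,
    [set U | exists s V, reduced_svd M U s V]%classic U).
  by exists U0, s0, V0.
rewrite -/(left_singular_mx M) in UU def_M *.
split=> //; exists (diag_mx s *m V^T); last by rewrite mulmxA.
have /row_fullP[L] := fullM; move: (left_singular_mx M) def_M => U ->.
by rewrite -[U *m _ *m _]mulmxA [LHS]mulmxA => /mulmx1_unit[].
Qed.

(** * Bessel's inequality and Khatri-Rao products *)

(** The residual [z] of projecting [y] onto the column space of [N] is orthogonal to it, so by
    Pythagoras the two sides differ by [|z|^2]. *)
Lemma bessel (R : realDomainType) (m n : nat) (N : 'M[R]_(m, n)) (y : 'rV[R]_m) :
  N^T *m N = 1%:M -> ((y *m N) *m (y *m N)^T) 0 0 <= (y *m y^T) 0 0.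
Proof.
move=> NN; rewrite -subr_ge0; pose z := y - y *m N *m N^T.
have zN : z *m N = 0 by rewrite mulmxBl -[y *m N *m _ *m _]mulmxA NN mulmx1 subrr.
suff -> : (y *m y^T) 0 0 - ((y *m N) *m (y *m N)^T) 0 0 = (z *m z^T) 0 0.
  by rewrite -sum_sqr_mulmx_tr sumr_ge0 // => j _; exact: sqr_ge0.
rewrite [in z^T]/z linearB /= [(_ *m N^T)^T]trmx_mul trmxK mulmxBr mulmxA zN.
by rewrite mul0mx subr0 mulmxBl trmx_mul mulmxA !mxE.
Qed.

Lemma khatri_raoE (R : realType) (I K J : nat)
    (A : 'M[R]_(I, J)) (B : 'M[R]_(K, J)) i j :
  khatri_rao A B i j = A (mxtens_unindex i).1 j * B (mxtens_unindex i).2 j.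
Proof. by rewrite !mxE. Qed.

Lemma khatri_rao_mul (R : realType) (I K J m n : nat)
    (U : 'M[R]_(I, m)) (V : 'M[R]_(K, n)) (A : 'M[R]_(m, J)) (B : 'M[R]_(n, J)) :
  khatri_rao (U *m A) (V *m B) = (U *t V) *m khatri_rao A B.
Proof.
apply/matrixP => i j; rewrite khatri_raoE !mxE mulr_sum.
by apply: eq_bigr => k _; rewrite khatri_raoE !mxE mulrACA.
Qed.

Lemma row_full_khatri_rao (R : realType) (I K J : nat)
    (A : 'M[R]_(I, J)) (B : 'M[R]_(K, J)) :
  row_full A -> row_full B -> row_full (khatri_rao A B).
Proof.
move=> /row_fullP[L LA] /row_fullP[L' LB]; apply/row_fullP.
(* After applying [L *t L'], the Khatri-Rao product of two identities is left; its rows of index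
   [(j, j)] form the identity. *)
pose f (j : 'I_J) := mxtens_index (j, j).
exists (rowsub f 1%:M *m (L *t L')).
rewrite -mulmxA -khatri_rao_mul LA LB mul_rowsub_mx mul1mx.
apply/matrixP => i j; rewrite mxE khatri_raoE mxtens_indexK /= !mxE.
by case: (i == j); rewrite ?mulr1 ?mulr0.
Qed.

Lemma tens_mx1 (R : comPzRingType) (m n : nat) :
  1%:M *t 1%:M = 1%:M :> 'M[R]_(m * n).
Proof.
apply/matrixP => i j.
case: (mxtens_indexP i) => i1 i2; case: (mxtens_indexP j) => j1 j2.
rewrite tensmxE !mxE (can_eq (@mxtens_indexK _ _)) xpair_eqE.
by case: eqP; case: eqP; rewrite ?mulr1 ?mulr0.
Qed.

Lemma leverage_score_ge0 (R : realType) (n d : nat) (M : 'M[R]_(n, d)) i :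
  0 <= leverage_score M i.
Proof. by apply: sumr_ge0 => j _; exact: sqr_ge0. Qed.

Lemma leverage_score_khatri_rao (R : realType) (I K J : nat)
    (A : 'M[R]_(I, J)) (B : 'M[R]_(K, J)) i :
  row_full A -> row_full B ->
  leverage_score (khatri_rao A B) i <=
  leverage_score A (mxtens_unindex i).1 * leverage_score B (mxtens_unindex i).2.
Proof.
move=> fullA fullB; rewrite /leverage_score.
have [] := left_singular_mxP fullA; move: (left_singular_mx A) => U UU [S _ def_A].
have [] := left_singular_mxP fullB; move: (left_singular_mx B) => V VV [T _ def_B].
have [] := left_singular_mxP (row_full_khatri_rao fullA fullB).
move: (left_singular_mx _) => Q QQ [W unitW def_C].
pose N := khatri_rao S T *m invmx W.
have def_Q : Q = (U *t V) *m N.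
  by rewrite /N mulmxA -khatri_rao_mul -def_A -def_B def_C mulmxK.
clearbody N.
(* By the mixed-product rule [U *t V] has orthonormal columns, so [Q^T *m Q] reduces to
   [N^T *m N]. *)
have NN : N^T *m N = 1%:M.
  rewrite def_Q trmx_mul trmx_tens mulmxA in QQ.
  by rewrite -[_ *m _ *m (U *t V)]mulmxA tensmx_mul UU VV tens_mx1 mulmx1 in QQ.
have := bessel (row i (U *t V)) NN; rewrite -row_mul -def_Q -!sum_sqr_mulmx_tr.
(* The product of the two row norms becomes one sum over pairs of columns, which is the squared norm
   of a row of [U *t V]. *)
rewrite mulr_sum.
under eq_bigr do rewrite mxE.
under [X in _ <= X -> _]eq_bigr do rewrite !mxE exprMn.
by [].
Qed.

Theorem lemma3p2 (R : realType) (I J K : nat)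
    (A : 'M[R]_(I, J)) (B : 'M[R]_(K, J))
    (hI : (J < I)%N) (hK : (J < K)%N)
    (hA : \rank A = J) (hB : \rank B = J) :
  coherence (khatri_rao A B) <= coherence A * coherence B.
Proof.
have coherence_ge n d (M : 'M[R]_(n, d)) i : leverage_score M i <= coherence M.
  exact: le_bigmax.
have coherence_ge0 n d (M : 'M[R]_(n, d)) : 0 <= coherence M.
  exact: bigmax_ge_id.
(* The default 0 of the maximum must also lie below the bound. *)
apply: bigmax_le => [|i _]; first by rewrite mulr_ge0.
have fullA : row_full A by exact/eqP.
have fullB : row_full B by exact/eqP.
apply: le_trans (leverage_score_khatri_rao i fullA fullB) _.
by rewrite ler_pM ?leverage_score_ge0.
Qed.
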